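(* There is a constant $C(\underline{d})$, depending only on $\underline{d}$ and $k$, such that the Zariski closure of $Z(k)$ in $Z$ has codimension $\le C(\underline{d})$.
   Context: Let $k$ be an infinite Brauer field, i.e. an infinite field such that for every $d \ge 1$ there is a quantity $N_k(d)$ such that any equation $a_1 x_1^d + \cdots + a_n x_n^d = 0$ with $n > N_k(d)$ and $a_i \in k$ has a non-trivial solution in $k$. Let $\underline{f}=(f_1,\ldots,f_r)$ be homogeneous polynomials on a finite-dimensional $k$-vector space $V$ of degrees $\underline{d}=(d_1,\ldots,d_r)$, and let $Z=Z(\underline{f})$ be the closed subvariety of $V$ defined by the vanishing of the $f_i$. *)

(* Defs.v *)
From mathcomp Require Import all_boot all_algebra.
From mathcomp Require Import mpoly.
Set Implicit Arguments. Unset Strict Implicit. Unset Printing Implicit Defensive.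
Import GRing.Theory.
Local Open Scope ring_scope.

Definition infinite_field (k : fieldType) : Prop :=
  forall s : seq k, exists x : k, x \notin s.

Definition brauer_field (k : fieldType) : Prop :=
  forall d : nat, (1 <= d)%N -> exists N : nat, forall n : nat, (N < n)%N ->
    forall a : 'I_n -> k, exists x : 'I_n -> k,
      (exists i, x i != 0) /\ \sum_(i < n) a i * x i ^+ d = 0.

Section Ideals.
Variables (k : fieldType) (n : nat).
Local Notation P := {mpoly k[n]}.

Definition is_ideal (I : P -> Prop) : Prop :=
  [/\ I 0, (forall a b, I a -> I b -> I (a + b)) &
      (forall r a, I a -> I (r * a))].

Definition is_prime_ideal (I : P -> Prop) : Prop :=
  [/\ is_ideal I, ~ I 1 & (forall a b, I (a * b) -> I a \/ I b)].

(* There is a chain Q_0 < Q_1 < ... < Q_L of prime ideals of k[x] containing J,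
   i.e. the Krull dimension of k[x]/J is at least L. *)
Definition has_prime_chain (J : P -> Prop) (L : nat) : Prop :=
  exists Q : nat -> P -> Prop,
    (forall j, (j <= L)%N -> is_prime_ideal (Q j) /\ (forall g, J g -> Q j g)) /\
    (forall j, (j < L)%N ->
       (forall g, Q j g -> Q j.+1 g) /\ (exists g, Q j.+1 g /\ ~ Q j g)).

(* dim Spec(k[x]/J) <= dim Spec(k[x]/I) + C : the closed set cut out by I
   has codimension at most C in the closed set cut out by J. *)
Definition codim_le (I J : P -> Prop) (C : nat) : Prop :=
  forall L, has_prime_chain J L -> has_prime_chain I (L - C).

Definition gen_ideal (r : nat) (f : 'I_r -> P) : P -> Prop :=
  fun g => exists h : 'I_r -> P, g = \sum_(i < r) h i * f i.

Definition kpoints (r : nat) (f : 'I_r -> P) : ('I_n -> k) -> Prop :=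
  fun a => forall i, (f i).@[a] = 0.

(* Vanishing ideal of Z(k); it defines the Zariski closure of Z(k). *)
Definition vanishing_ideal (S : ('I_n -> k) -> Prop) : P -> Prop :=
  fun g => forall a, S a -> g.@[a] = 0.

End Ideals.

(* Main.v *)
(** Brauer's theorem for systems provides an N depending only on the degrees such that
    the forms have a nontrivial common zero on every k-subspace of dimension > N: one
    kills the mixed terms of the forms of top degree by choosing vectors one at a time
    (the conditions have lower degree), which leaves a diagonal system.  The closure X of
    Z(k) is therefore a cone meeting every k-subspace of dimension > N outside 0.  Cutting
    X by n - N - 1 generic k-rational linear forms, each of which lies in no minimal prime
    other than the ideal of the origin, lowers the dimension at every step, and what remains
    contains a line; hence dim X >= n - N.  As dim Z <= n, the codimension is at most N. *)
Require Import Defs.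
From mathcomp Require Import all_boot all_order all_algebra.
From mathcomp Require Import mpoly.
From Stdlib Require Import Classical IndefiniteDescription Wellfounded.
Set Implicit Arguments. Unset Strict Implicit. Unset Printing Implicit Defensive.
Import Order.TTheory GRing.Theory.
Local Open Scope ring_scope.

(** * Systems of forms over a Brauer field *)

Section Polarization.
Variable k : fieldType.

Lemma dhomog_bigprod n (I : finType) (e : I -> nat) (F : I -> {mpoly k[n]}) :
  (forall i, F i \is (e i).-homog) -> \prod_i F i \is (\sum_i e i)%N.-homog.
Proof.
move=> hF; elim/big_rec2: _ => [|i d p _ hp]; first exact: dhomog1.
exact: dhomogM.
Qed.

(** A multilinear form as a list of terms: a coefficient and one coordinate index per slot. It is
    not symmetrized, so no factorial is inverted and any characteristic is allowed. *)
Definition polar n d (S : seq (k * {ffun 'I_d -> 'I_n})) (u : 'I_d -> 'I_n -> k) : k :=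
  \sum_(t <- S) t.1 * \prod_q u q (t.2 q).

Lemma eq_polar n d (S : seq (k * {ffun 'I_d -> 'I_n})) u v :
  (forall q, u q = v q) -> polar S u = polar S v.
Proof.
by move=> e; apply: eq_bigr => t _; congr (_ * _); apply: eq_bigr => q _; rewrite e.
Qed.

Lemma monomial_eval n d (m : 'X_{1..n}) : mdeg m = d ->
  exists phi : {ffun 'I_d -> 'I_n}, forall v : 'I_n -> k,
    \prod_i v i ^+ m i = \prod_q v (phi q).
Proof.
move=> hm; have hs : size (m2s m) == d by rewrite size_m2s hm.
exists [ffun q => tnth (Tuple hs) q] => v.
under [RHS]eq_bigr do rewrite ffunE.
rewrite -[RHS](big_tuple _ _ (Tuple hs) predT v) /= -{1}(s2mK m).
elim: (m2s m) => [|x s IH].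
  by rewrite big_nil big1 // => i _; rewrite mnmE.
rewrite big_cons -IH (bigD1 x) //= [in RHS](bigD1 x) //= mulrA; congr (_ * _).
  by rewrite !mnmE /= eqxx exprS.
by apply: eq_bigr => i /negPf ne; rewrite !mnmE /= eq_sym ne.
Qed.

Lemma polarization n d (f : {mpoly k[n]}) : f \is d.-homog ->
  exists S : seq (k * {ffun 'I_d -> 'I_n}), forall v, f.@[v] = polar S (fun=> v).
Proof.
move=> /dhomogP hf.
suff: exists S : seq (k * {ffun 'I_d -> 'I_n}), forall v,
    \sum_(m <- msupp f) f@_m * \prod_i v i ^+ m i = polar S (fun=> v).
  by case=> S hS; exists S => v; rewrite mevalE hS.
elim: (msupp f) hf => [|m s IH] hs.
  by exists [::] => v; rewrite /polar !big_nil.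
have [|S hS] := IH; first by move=> x xs; apply: hs; rewrite inE xs orbT.
have [phi hphi] := monomial_eval (hs m (mem_head _ _)).
by exists ((f@_m, phi) :: S) => v; rewrite /polar !big_cons hS hphi.
Qed.

(** Multilinearity; [psi] records which vector fills each slot. *)
Lemma polar_expand n d (S : seq (k * {ffun 'I_d -> 'I_n})) (J : finType)
  (x : J -> k) (v : J -> 'I_n -> k) :
  polar S (fun=> fun a => \sum_s x s * v s a) =
  \sum_(psi : {ffun 'I_d -> J}) (\prod_q x (psi q)) * polar S (fun q => v (psi q)).
Proof.
rewrite /polar; under eq_bigr do rewrite bigA_distr_bigA big_distrr /=.
rewrite exchange_big /=; apply: eq_bigr => psi _.
rewrite big_distrr /=; apply: eq_bigr => t _.
by rewrite big_split /= mulrCA.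
Qed.

(* [polar S (u \o psi)] as a polynomial in the single vector [u j]. *)
Definition polar_slot n d (S : seq (k * {ffun 'I_d -> 'I_n})) (J : finType)
    (u : J -> 'I_n -> k) (psi : {ffun 'I_d -> J}) (j : J) : {mpoly k[n]} :=
  \sum_(t <- S) t.1 *:
    \prod_q (if psi q == j then 'X_(t.2 q) else (u (psi q) (t.2 q))%:MP).

Lemma polar_slot_homog n d (S : seq (k * {ffun 'I_d -> 'I_n})) (J : finType)
    (u : J -> 'I_n -> k) (psi : {ffun 'I_d -> J}) (j : J) :
  polar_slot S u psi j \is #|[pred q | psi q == j]|.-homog.
Proof.
apply: rpred_sum => t _; apply: rpredZ.
have -> : #|[pred q | psi q == j]| = (\sum_q (psi q == j))%N.
  by rewrite -sum1_card big_mkcond; apply: eq_bigr => q _; rewrite inE; case: eqP.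
apply: dhomog_bigprod => q; case: eqP => _; first by rewrite dhomogX /= mdeg1.
by rewrite -[_%:MP]mulr1 mul_mpolyC; apply: rpredZ; apply: dhomog1.
Qed.

Lemma polar_slotE n d (S : seq (k * {ffun 'I_d -> 'I_n})) (J : finType)
    (u : J -> 'I_n -> k) (psi : {ffun 'I_d -> J}) (j : J) w :
  (polar_slot S u psi j).@[w] = polar S (fun q => if psi q == j then w else u (psi q)).
Proof.
rewrite /polar_slot raddf_sum; apply: eq_bigr => t _ /=.
rewrite mevalZ rmorph_prod; congr (_ * _); apply: eq_bigr => q _ /=.
by case: ifP => _; rewrite ?mevalXU ?mevalC.
Qed.

Lemma linear_form_eval n (f : {mpoly k[n]}) : f \is 1.-homog ->
  exists c : 'I_n -> k, forall v, f.@[v] = \sum_a c a * v a.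
Proof.
move=> /polarization [S hS].
exists (fun a => \sum_(t <- S | t.2 ord0 == a) t.1) => v.
rewrite hS /polar; under [RHS]eq_bigr do rewrite big_distrl big_mkcond /=.
rewrite exchange_big /=; apply: eq_bigr => t _.
by rewrite big_ord1 -big_mkcond /= (eq_bigl (pred1 (t.2 ord0))) ?big_pred1_eq.
Qed.

End Polarization.

(** * Brauer's theorem for systems, by induction on the largest degree *)

Section Brauer.
Variable k : fieldType.

(** The index type is arbitrary because the induction uses systems indexed by sets of maps. [N] is
    chosen before [n] and [f], so it depends only on [k] and the degrees. *)
Definition brauer_upto (D : nat) : Prop :=
  forall (I : finType) (e : I -> nat), (forall i, 0 < e i <= D)%N ->
  exists N, forall n, (N < n)%N -> forall f : I -> {mpoly k[n]},
    (forall i, f i \is (e i).-homog) ->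
    exists v : 'I_n -> k, (exists a, v a != 0) /\ forall i, (f i).@[v] = 0.

Lemma brauer_linear : brauer_upto 1.
Proof.
move=> I e he; exists #|I| => n hn f hf.
have {}hf i : f i \is 1.-homog.
  by have := hf i; have := he i; case: (e i) => [|[]].
have [c hc] := fin_all_exists (fun i => linear_form_eval (hf i)).
pose M : 'M[k]_(n, #|I|) := \matrix_(a, q) c (enum_val q) a.
have : kermx M != 0.
  rewrite -mxrank_eq0 mxrank_ker -lt0n subn_gt0.
  exact: leq_ltn_trans (rank_leq_col M) hn.
case/rowV0Pn => v /sub_kermxP vM v0.
exists (fun a => v 0 a); split; first by case/rV0Pn: v0 => a; exists a.
move=> i; rewrite hc; move/rowP/(_ (enum_rank i)): vM; rewrite !mxE => {2}<-.
by apply: eq_bigr => a _; rewrite mxE enum_rankK mulrC.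
Qed.

Hypothesis hbr : brauer_field k.

(** Induction on [r]: each old variable becomes a block of [N.+1] new ones, on which the first
    equation has a zero [u s]. Scaling the blocks by [y s] preserves that equation and turns the
    others into a diagonal system in [y]. *)
Lemma diagonal_system d r : (0 < d)%N ->
  exists J : finType, forall a : 'I_r -> J -> k, exists x : J -> k,
    (exists s, x s != 0) /\ forall i, \sum_s a i s * x s ^+ d = 0.
Proof.
move=> d0; elim: r => [|r [J hJ]].
  by exists unit => a; exists (fun=> 1); split=> [|[]//]; exists tt; apply: oner_neq0.
have [N hN] := hbr d0; exists (J * 'I_N.+1)%type => a.
have [u hu] := fin_all_exists (fun s => hN N.+1 (ltnSn N) (fun b => a ord0 (s, b))).
have [y [[s ys] hy]] :=
  hJ (fun i s => \sum_b a (lift ord0 i) (s, b) * u s b ^+ d).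
exists (fun p => y p.1 * u p.1 p.2); split.
  by case: (hu s) => -[b ub] _; exists (s, b); rewrite mulf_neq0.
move=> i; transitivity (\sum_s \sum_b a i (s, b) * (y s * u s b) ^+ d).
  by rewrite pair_bigA; apply: eq_bigr => -[].
have E s' : \sum_b a i (s', b) * (y s' * u s' b) ^+ d =
            (\sum_b a i (s', b) * u s' b ^+ d) * y s' ^+ d.
  by rewrite big_distrl; apply: eq_bigr => b _; rewrite exprMn /= mulrA mulrAC.
under eq_bigr do rewrite E.
case: (unliftP ord0 i) => [i' ->|->]; first exact: hy.
by rewrite big1 // => s' _; case: (hu s') => _ ->; rewrite mul0r.
Qed.

(* The [v s] are independent because [v s] is nonzero at the pivot [p s], where
   all later vectors vanish. *)
Lemma diagonalizing_vectors D (I : finType) (e : I -> nat) m :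
  (0 < D)%N -> brauer_upto D -> (forall i, 0 < e i)%N ->
  forall j, (j <= m)%N -> exists N, forall n, (N < n)%N ->
  forall S : forall i, seq (k * {ffun 'I_(e i) -> 'I_n}),
  exists (v : 'I_m -> 'I_n -> k) (p : 'I_m -> 'I_n),
  [/\ forall s : 'I_m, (s < j)%N -> v s (p s) != 0,
      forall s t : 'I_m, (s < t < j)%N -> v t (p s) = 0 &
      forall i (psi : {ffun 'I_(e i) -> 'I_m}), (forall q, psi q < j)%N ->
        (forall s, #|[pred q | psi q == s]| <= D)%N ->
        polar (S i) (fun q => v (psi q)) = 0].
Proof.
move=> D0 hD he; elim=> [|j IH] hj.
  exists 0%N => n hn S; exists (fun _ _ => 0), (fun=> Ordinal hn).
  by split=> [||i psi] //; move=> /(_ (Ordinal (he i))).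
have [N hN] := IH (ltnW hj); pose jo := Ordinal hj.
(* [K] indexes the conditions on the next vector [w]: one for each [psi] that puts it in between 1
   and [D] slots, and a linear one for each earlier pivot. The remaining indices carry the zero
   form, in degree 1. *)
pose K : finType := ({i : I & {ffun 'I_(e i) -> 'I_m}} + 'I_m)%type.
pose c (z : {i : I & {ffun 'I_(e i) -> 'I_m}}) := #|[pred q | tagged z q == jo]|.
pose ok z := (0 < c z <= D)%N.
pose e' (z : K) : nat :=
  match z with inl z => if ok z then c z else 1%N | inr _ => 1%N end.
have he' z : (0 < e' z <= D)%N.
  by case: z => [z|s] //=; case: ifP.
have [N' hN'] := hD K e' he'.
exists (maxn N N') => n; rewrite gtn_max => /andP[hn hn'] S.
have [v [p [hp hpz hpol]]] := hN n hn S.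
pose f (z : K) : {mpoly k[n]} := match z with
  | inl z => if ok z then polar_slot (S (tag z)) v (tagged z) jo else 0
  | inr s => if (s < j)%N then 'X_(p s) else 0 end.
have hf z : f z \is (e' z).-homog.
  case: z => [z|s] /=; case: ifP => _; rewrite ?dhomog0 //.
    exact: polar_slot_homog.
  by rewrite dhomogX /= mdeg1.
have [w [[a wa] hw]] := hN' n hn' f hf.
exists (fun s => if s == jo then w else v s), (fun s => if s == jo then a else p s).
have lt_ne (s : 'I_m) : (s < j.+1)%N -> s != jo -> (s < j)%N.
  by rewrite ltnS leq_eqVlt -val_eqE => /orP[->|].
split=> [s hs|s t /andP[st tj]|i psi hpsi hfib].
- by case: ifP => // /negbT ne; apply: hp; apply: lt_ne.
- have sj : (s < j)%N by apply: leq_trans st _; rewrite -ltnS.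
  have -> : (s == jo) = false by rewrite -val_eqE ltn_eqF.
  case: ifP => [_|/negbT ne]; last by apply: hpz; rewrite st lt_ne.
  by have := hw (inr s); rewrite /= sj mevalXU.
have [c0|cpos] := posnP (c (Tagged (fun i => {ffun 'I_(e i) -> 'I_m}) psi)).
  have ne q : psi q != jo.
    by move/card0_eq: c0 => /(_ q); rewrite inE => ->.
  rewrite -[RHS](hpol i psi) // => [|q]; last exact: lt_ne.
  by apply: eq_polar => q; rewrite (negPf (ne q)).
have := hw (inl (Tagged (fun i => {ffun 'I_(e i) -> 'I_m}) psi)).
by rewrite /= /ok cpos hfib polar_slotE.
Qed.

(** A fibre of [psi] with more than [D] elements forces degree [D.+1] and a constant [psi]. On the
    diagonalizing vectors all other terms vanish, which leaves a diagonal system. *)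
Lemma brauer_step D : (0 < D)%N -> brauer_upto D -> brauer_upto D.+1.
Proof.
move=> D0 hD I e he.
have e0 i : (0 < e i)%N by case/andP: (he i).
have [J hJ] := @diagonal_system D.+1 #|I| (ltn0Sn D).
have [N hN] := @diagonalizing_vectors D I e #|J| D0 hD e0 _ (leqnn _).
exists N => n hn f hf.
have [S hS] := fin_all_exists (fun i => polarization (hf i)).
have [v [p [hp hpz hpol]]] := hN n hn S.
pose a (i : I) (s : 'I_#|J|) :=
  if e i == D.+1 then polar (S i) (fun=> v s) else 0.
have [x [[s0 xs0] hx]] := hJ (fun q s => a (enum_val q) (enum_rank s)).
pose y (s : 'I_#|J|) := x (enum_val s).
have hy i : \sum_s a i s * y s ^+ D.+1 = 0.
  rewrite -[RHS](hx (enum_rank i)) [RHS](reindex_onto enum_val enum_rank) /=.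
    by apply: eq_big => [s|s _]; rewrite ?enum_valK ?eqxx ?enum_rankK.
  by move=> s _; rewrite enum_rankK.
exists (fun b => \sum_s y s * v s b); split.
  have ys0 : y (enum_rank s0) != 0 by rewrite /y enum_rankK.
  (* The combination is nonzero at the pivot of the first [s] with [y s != 0]: earlier coefficients
     are 0 and later vectors vanish there. *)
  case: (@arg_minnP _ (enum_rank s0) (fun s => y s != 0) (fun s => nat_of_ord s) ys0).
  move=> s ys smin; exists (p s); rewrite (bigD1 s) //= big1 ?addr0 => [|t ts].
    by rewrite mulf_neq0 // hp.
  have [ts'|st] := ltnP t s.
    have [->|/smin] := eqVneq (y t) 0; first by rewrite mul0r.
    by rewrite leqNgt ts'.
  by rewrite hpz ?mulr0 // ltn_ord andbT ltn_neqAle st andbT eq_sym.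
move=> i; rewrite hS polar_expand -[RHS](hy i).
have [ei|ei] := eqVneq (e i) D.+1; last first.
  rewrite [RHS]big1 => [|s _]; last by rewrite /a (negPf ei) mul0r.
  rewrite big1 // => psi _; rewrite hpol ?mulr0 // => s.
  apply: leq_trans (max_card _) _; rewrite card_ord.
  by case/andP: (he i) => _; rewrite leq_eqVlt (negPf ei).
pose F (psi : {ffun 'I_(e i) -> 'I_#|J|}) :=
  (\prod_q y (psi q)) * polar (S i) (fun q => v (psi q)).
have E psi : F psi = \sum_s (psi == [ffun=> s])%:R * F psi.
  have [/existsP[s /eqP ->]|] := boolP [exists s, psi == [ffun=> s]].
    rewrite (bigD1 s) //= eqxx mul1r big1 ?addr0 // => t ts.
    case: eqP => [/ffunP/(_ (Ordinal (e0 i)))|]; last by rewrite mul0r.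
    by rewrite !ffunE => st; rewrite st eqxx in ts.
  rewrite negb_exists => /forallP nc.
  suff -> : F psi = 0 by rewrite big1 // => s _; rewrite mulr0.
  rewrite /F hpol ?mulr0 // => s; rewrite -ltnS -ei ltnNge.
  apply: contra (nc s) => le; apply/eqP/ffunP => q; rewrite ffunE.
  have /subset_cardP : #|[pred q | psi q == s]| = #|'I_(e i)|.
    by apply/eqP; rewrite eqn_leq max_card card_ord.
  by move=> /(_ (subset_predT _))/(_ q); rewrite !inE => /eqP.
under eq_bigr do rewrite -/(F _) E.
rewrite exchange_big /=; apply: eq_bigr => s _.
rewrite (bigD1 [ffun=> s]) //= eqxx mul1r big1 ?addr0 => [|psi /negPf ->]; last by rewrite mul0r.
have -> : a i s = polar (S i) (fun=> v s) by rewrite /a ifT //; apply/eqP.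
rewrite /F mulrC; congr (_ * _); first by apply: eq_polar => q; rewrite ffunE.
by under eq_bigr do rewrite ffunE; rewrite prodr_const card_ord; congr (_ ^+ _).
Qed.

Theorem brauer_systems D : (0 < D)%N -> brauer_upto D.
Proof.
elim: D => // -[_ _|D IH _]; first exact: brauer_linear.
by apply: brauer_step => //; apply: IH.
Qed.

End Brauer.

(** * Lengths of prime chains *)

Section IdealTheory.
Variables (k : fieldType) (n : nat).
Local Notation P := {mpoly k[n]}.
Implicit Types (I Q : P -> Prop).

Lemma idealN I p : is_ideal I -> I p -> I (- p).
Proof. by case=> _ _ hM Ip; rewrite -mulN1r; apply: hM. Qed.

Lemma idealB I p q : is_ideal I -> I p -> I q -> I (p - q).
Proof. by move=> idI Ip Iq; case: (idI) => _ hD _; apply: hD => //; apply: idealN. Qed.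

Lemma idealMr I p q : is_ideal I -> I p -> I (p * q).
Proof. by case=> _ _ hM Ip; rewrite mulrC; apply: hM. Qed.

Lemma idealZ I c p : is_ideal I -> I p -> I (c *: p).
Proof. by case=> _ _ hM Ip; rewrite -mul_mpolyC; apply: hM. Qed.

Lemma ideal_sum I (T : Type) (r : seq T) (B : pred T) (F : T -> P) :
  is_ideal I -> (forall i, B i -> I (F i)) -> I (\sum_(i <- r | B i) F i).
Proof. by case=> h0 hD _ hF; elim/big_ind: _. Qed.

Lemma ideal_const I c : is_ideal I -> c != 0 -> I c%:MP -> I 1.
Proof.
move=> idI c0 Ic; suff -> : 1 = c^-1 *: c%:MP :> P by apply: idealZ.
by rewrite -mul_mpolyC -mpolyCM mulVf.
Qed.

Lemma prime_expr Q p m : is_prime_ideal Q -> ~ Q p -> ~ Q (p ^+ m).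
Proof.
case=> idQ Q1 QM Qp; elim: m => [|m IH]; first by rewrite expr0.
by rewrite exprS => /QM[].
Qed.

(* If some coefficient were nonzero, dividing by the least power of [a 0] and reducing
   modulo [Q 1], then doing the same with [a 1], and so on, would leave only the
   coefficient of the lexicographically least exponent, as an element of [Q L]. *)
Lemma leading_exponents_vanish L (Q : nat -> P -> Prop) (a : 'I_L -> P) M
    (c : {ffun 'I_L -> 'I_M} -> k) :
  (forall j, (j <= L)%N -> is_prime_ideal (Q j)) ->
  (forall j, (j < L)%N -> forall g, Q j g -> Q j.+1 g) ->
  (forall j : 'I_L, Q j.+1 (a j) /\ ~ Q j (a j)) ->
  Q 0%N (\sum_alpha c alpha *: \prod_i a i ^+ alpha i) ->
  forall alpha, c alpha = 0.
Proof.
move=> hQ hinc ha h0 alpha0; apply/eqP/negPn/negP => calpha0.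
(* [A] holds the exponents surviving at stage [j]; they agree in the first [j] coordinates, whose
   powers have been divided out. *)
have /(_ L (leqnn _)) [A [[al Aal] Ac Aeq]] : forall j, (j <= L)%N ->
    exists A : {set {ffun 'I_L -> 'I_M}}, [/\ exists al, al \in A,
      forall al, al \in A -> c al != 0,
      forall al be, al \in A -> be \in A -> forall i : 'I_L, (i < j)%N -> al i = be i &
      Q j (\sum_(al in A) c al *: \prod_(i : 'I_L | (j <= i)%N) a i ^+ al i)].
  elim=> [_|j IH hj].
    exists [set al | c al != 0]; split=> //.
    - by exists alpha0; rewrite inE.
    - by move=> al; rewrite inE.
    move: h0; rewrite (bigID (fun al => c al != 0)) /= addrC big1 ?add0r.
      by congr (Q _ _); apply: eq_bigl => al; rewrite inE.
    by move=> al /negPn/eqP ->; rewrite scale0r.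
  have [A [[al Aal] Ac Aeq QA]] := IH (ltnW hj).
  pose jo := Ordinal hj.
  have [{}al {}Aal almin] : exists2 al, al \in A & forall be, be \in A -> (al jo <= be jo)%N.
    by case: (@arg_minnP _ al (mem A) (fun al => al jo) Aal) => al' ? ?; exists al'.
  set m := al jo in almin.
  have [[idQ _ QM] [idQ' _ _]] := (hQ j (ltnW hj), hQ j.+1 hj).
  have [aj' aj] := ha jo.
  pose G (be : {ffun 'I_L -> 'I_M}) :=
    c be *: (a jo ^+ (be jo - m) * \prod_(i : 'I_L | (j < i)%N) a i ^+ be i).
  have QG : Q j.+1 (\sum_(be in A) G be).
    apply: hinc => //.
    have : Q j (a jo ^+ m * \sum_(be in A) G be).
      move: QA; congr (Q _ _); rewrite big_distrr; apply: eq_bigr => be Abe.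
      rewrite /G /= -scalerAr mulrA -exprD subnKC; last exact: almin.
      rewrite (bigD1 jo) //=; congr (_ *: (_ * _)); apply: eq_bigl => i.
      by rewrite -val_eqE /= ltn_neqAle andbC eq_sym.
    by case/QM => // /(prime_expr (hQ j (ltnW hj)) aj).
  exists [set be in A | be jo == m :> nat]; split.
  - by exists al; rewrite inE Aal eqxx.
  - by move=> be; rewrite inE => /andP[/Ac].
  - move=> be ga; rewrite !inE => /andP[Abe /eqP mbe] /andP[Aga /eqP mga] i.
    rewrite ltnS leq_eqVlt => /orP[/eqP ij|]; last exact: Aeq.
    by have -> : i = jo; [apply: val_inj | apply: val_inj; rewrite /= mbe mga].
  move: QG; rewrite (bigID (fun be : {ffun 'I_L -> 'I_M} => be jo == m :> nat)) /=.
  set s1 := \sum_(_ in A | _) _; set s2 := \sum_(_ in A | _) _ => QG.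
  have -> : \sum_(be in [set be in A | be jo == m :> nat])
      c be *: \prod_(i : 'I_L | (j < i)%N) a i ^+ be i = s1 + s2 - s2.
    rewrite addrK; apply: eq_big => [be|be]; first by rewrite inE.
    by rewrite inE => /andP[_ /eqP mbe]; rewrite /G mbe subnn mul1r.
  apply: idealB => //; apply: ideal_sum => // be /andP[Abe ne].
  apply: idealZ => //; apply: idealMr => //.
  have : (0 < be jo - m)%N by rewrite subn_gt0 ltn_neqAle eq_sym ne; apply: almin.
  by case: (be jo - m)%N => // q _; rewrite exprS; apply: idealMr.
have [idQ Q1 _] := hQ L (leqnn _).
have -> : A = [set al].
  apply/setP => be; rewrite inE; apply/idP/eqP => [Abe|->//].
  by apply/ffunP => i; apply: Aeq.
rewrite big_set1 big1 => [|i]; last by rewrite leqNgt ltn_ord.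
by rewrite -mul_mpolyC mulr1 => /(ideal_const idQ (Ac _ Aal)).
Qed.

(** [msize] is the total degree plus one, and 0 for the zero polynomial; hence the shifted
    bounds. *)
Lemma msizeM_bound (p q : P) d e : (msize p <= d.+1)%N -> (msize q <= e.+1)%N ->
  (msize (p * q) <= (d + e).+1)%N.
Proof.
move=> hp hq; have [->|p0] := eqVneq p 0; first by rewrite mul0r msize0.
have [->|q0] := eqVneq q 0; first by rewrite mulr0 msize0.
rewrite msizeM // -ltnS prednK; last by rewrite addn_gt0 lt0n mmeasure_poly_eq0 p0.
by apply: leq_trans (leq_add hp hq) _; rewrite addSn addnS.
Qed.

Lemma msizeX_bound (p : P) d m : (msize p <= d.+1)%N -> (msize (p ^+ m) <= (m * d).+1)%N.
Proof.
move=> hp; elim: m => [|m IH]; first by rewrite expr0 msize1.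
by rewrite exprS mulSn; apply: msizeM_bound.
Qed.

Lemma msize_prod_bound L (F : 'I_L -> P) d :
  (forall i, msize (F i) <= d.+1)%N -> (msize (\prod_i F i) <= (L * d).+1)%N.
Proof.
move=> hF; rewrite -[L in (L * d)%N]card_ord -sum_nat_const.
by elim/big_rec2: _ => [|i e p _ hp]; [rewrite msize1 | apply: msizeM_bound].
Qed.

(* The [M ^ L] monomials in the [a i] lie in a space of dimension at most
   [(M * K) ^ n], which is smaller as soon as [M > K ^ n] and [L > n]. *)
Lemma algebraic_dependence L (a : 'I_L -> P) : (n < L)%N ->
  exists M (c : {ffun 'I_L -> 'I_M} -> k),
    (exists alpha, c alpha != 0) /\ \sum_alpha c alpha *: \prod_i a i ^+ alpha i = 0.
Proof.
move=> nL; pose D := (\max_i msize (a i))%N.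
pose K := (L * D).+1; pose M := (K ^ n).+1; pose B := (L * (M * D)).+1.
exists M.
pose mon (be : {ffun 'I_n -> 'I_B}) : 'X_{1..n} := [multinom nat_of_ord (be i) | i < n].
pose pow (al : {ffun 'I_L -> 'I_M}) := \prod_i a i ^+ al i.
have hpow al : (msize (pow al) <= B)%N.
  apply: msize_prod_bound => i; apply: (@leq_trans (al i * D).+1).
    by apply: msizeX_bound; apply: leqW; apply: leq_bigmax.
  by rewrite ltnS leq_mul2r (ltnW (ltn_ord _)) orbT.
(* Each row holds the coefficients of one power product, so a vector of the left kernel is a linear
   relation between the products. *)
pose N : 'M[k]_(#|{ffun 'I_L -> 'I_M}|, #|{ffun 'I_n -> 'I_B}|) :=
  \matrix_(al, be) (pow (enum_val al))@_(mon (enum_val be)).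
have : kermx N != 0.
  rewrite -mxrank_eq0 mxrank_ker -lt0n subn_gt0.
  apply: leq_ltn_trans (rank_leq_col N) _; rewrite !card_ffun !card_ord.
  apply: (@leq_trans (M ^ n.+1)); last by rewrite leq_pexp2l.
  have hB : (B <= M * K)%N by rewrite /B /K mulnS mulnCA -add1n leq_add2r.
  apply: (@leq_ltn_trans ((M * K) ^ n)).
    by case: (posnP n) => [->//|n0]; rewrite leq_exp2r.
  by rewrite expnMn expnSr ltn_pmul2l ?expn_gt0.
case/rowV0Pn => v /sub_kermxP vN v0.
exists (fun al => v 0 (enum_rank al)); split.
  by case/rV0Pn: v0 => i vi; exists (enum_val i); rewrite enum_valK.
apply/mpolyP => m; rewrite mcoeff0 raddf_sum /=.
have [/forallP hm|] := boolP [forall i, (m i < B)%N]; last first.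
  rewrite negb_forall => /existsP[i]; rewrite -leqNgt => hm.
  rewrite big1 // => al _; rewrite mcoeffZ memN_msupp_eq0 ?mulr0 //.
  apply: msize_mdeg_ge; apply: leq_trans (hpow al) (leq_trans hm _).
  by rewrite mdegE (bigD1 i) //= leq_addr.
pose be : {ffun 'I_n -> 'I_B} := [ffun i => Ordinal (hm i)].
have -> : m = mon be by apply/mnmP => i; rewrite mnmE ffunE.
move/rowP/(_ (enum_rank be)): vN; rewrite !mxE => {2}<-.
rewrite (reindex_onto enum_val enum_rank) /=; last by move=> al _; rewrite enum_rankK.
apply: eq_big => [i|i _]; first by rewrite enum_valK eqxx.
by rewrite enum_valK mcoeffZ mxE enum_rankK.
Qed.

(** Elements of [Q j.+1] outside [Q j], one for each step, are algebraically independent, which is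
    impossible for more than [n] polynomials. *)
Theorem prime_chain_length (J : P -> Prop) L : has_prime_chain J L -> (L <= n)%N.
Proof.
case=> Q [hQ hstep]; rewrite leqNgt; apply/negP => nL.
have /fin_all_exists[a ha] : forall j : 'I_L, exists g, Q j.+1 g /\ ~ Q j g.
  by move=> j; case: (hstep j (ltn_ord j)).
have [M [c [[al cal] csum]]] := algebraic_dependence a nL.
have := @leading_exponents_vanish L Q a M c.
move=> /(_ (fun j hj => proj1 (hQ j hj)) (fun j hj => proj1 (hstep j hj)) ha).
rewrite csum; case: (hQ 0%N isT) => -[[Q0 _ _] _ _] _ /(_ Q0 al) c0.
by rewrite c0 eqxx in cal.
Qed.

End IdealTheory.

(** * Finiteness of minimal primes *)

Section Noetherian.

Lemma wf_minimal (T : Type) (R : T -> T -> Prop) (A : T -> Prop) :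
  well_founded R -> (exists x, A x) ->
  exists x, A x /\ forall y, A y -> ~ R y x.
Proof.
move=> wfR [x]; elim/(well_founded_ind wfR): x => x IH Ax.
have [[y [Ay yx]]|hx] := classic (exists y, A y /\ R y x); first exact: IH yx Ay.
by exists x; split=> // y Ay yx; apply: hx; exists y.
Qed.

(** [h N] is a place where [g] attains its minimum over the indices from [N] on; iterating past the
    previous place never lowers the value. *)
Lemma monotone_subsequence (g : nat -> nat) : exists phi : nat -> nat,
  (forall i, phi i < phi i.+1)%N /\ (forall i, g (phi i) <= g (phi i.+1))%N.
Proof.
have /functional_choice[h hh] : forall N, exists i, (N <= i)%N /\
    forall j, (N <= j)%N -> (g i <= g j)%N.
  move=> N; have [||i [Ni hi]] := @wf_minimal nat (fun i j => g i < g j)%N (leq N).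
  - suff acc b i : (g i < b)%N -> Acc (fun i j => g i < g j)%N i.
      by move=> i; apply: acc (ltnSn _).
    elim: b i => [|b IH] i; first by rewrite ltn0.
    by rewrite ltnS => gi; constructor=> j gj; apply: IH; apply: leq_trans gj gi.
  - by exists N; rewrite leqnn.
  by exists i; split=> // j /hi/negP; rewrite -leqNgt.
pose phi := fix phi i := if i is i'.+1 then h (phi i').+1 else h 0%N.
have lt_phi i : (phi i < phi i.+1)%N by case: (hh (phi i).+1).
exists phi; split=> // -[|i]; first by apply: (hh 0%N).2.
by apply: (hh (phi i).+1).2; apply: ltn_trans (lt_phi i) (lt_phi i.+1).
Qed.

Lemma homo_leq_step (f : nat -> nat) :
  (forall i, f i <= f i.+1)%N -> forall i j, (i <= j)%N -> (f i <= f j)%N.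
Proof. by move=> hf; apply: (homo_leq leqnn leq_trans). Qed.

(** Each coordinate is made monotone by passing to a further subsequence; the first two terms of the
    last one are comparable. *)
Lemma dickson n (m : nat -> 'X_{1..n}) :
  exists i j, (i < j)%N /\ (m i <= m j)%MM.
Proof.
suff [phi [lt_phi hphi]] : exists phi : nat -> nat, (forall i, phi i < phi i.+1)%N /\
    forall a, a \in enum 'I_n -> forall i, (m (phi i) a <= m (phi i.+1) a)%N.
  exists (phi 0%N), (phi 1%N); split=> //.
  by apply/mnm_lepP => a; apply: hphi; rewrite mem_enum.
elim: (enum 'I_n) => [|a s [phi [lt_phi hphi]]]; first by exists id.
have [psi [lt_psi hpsi]] := monotone_subsequence (fun i => m (phi i) a).
exists (phi \o psi); split=> [i|b] /=.
  have : forall i j, (i < j)%N -> (phi i < phi j)%N by apply: (homo_ltn ltn_trans).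
  by apply.
rewrite inE => /predU1P[->//|bs] i.
by apply: (homo_leq_step (hphi b bs)); apply: ltnW.
Qed.

Variables (k : fieldType) (n : nat).
Local Notation P := {mpoly k[n]}.

(** Hilbert's basis theorem in chain form, by Dickson's lemma for leading monomials. *)
Lemma no_ascending_ideals (I : nat -> P -> Prop) :
  (forall j, is_ideal (I j)) -> (forall j g, I j g -> I j.+1 g) ->
  ~ (forall j, exists g, I j.+1 g /\ ~ I j g).
Proof.
move=> idI incI hstep.
have {incI} incI i j : (i <= j)%N -> forall g, I i g -> I j g.
  by move/subnK <-; elim: (j - i)%N => // d IH g /IH; apply: incI.
have /functional_choice[g hg] : forall j, exists g, (I j.+1 g /\ ~ I j g) /\
    forall h, I j.+1 h /\ ~ I j h -> ~ (mlead h < mlead g)%O.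
  move=> j; apply: (@wf_minimal _ (fun g h : P => mlead g < mlead h)%O).
    exact: (wf_inverse_image _ _ _ (@mlead n k) (@ltom_wf n)).
  exact: hstep.
(* [g j] has the least leading monomial in [I j.+1] outside [I j], but subtracting a
   multiple of some earlier [g i] cancels that monomial. *)
have [i [j [ij]]] := dickson (fun j => mlead (g j)).
have [[[gi _] _] [[gj ngj] gmin]] := (hg i, hg j).
have nz q : ~ I q (g q) -> g q != 0.
  by move=> ngq; apply/eqP => gq; apply: ngq; rewrite gq; case: (idI q).
have gi0 : g i != 0 by apply: nz; case: (hg i) => -[].
have gj0 : g j != 0 by apply: nz.
set mi := mlead (g i); set mj := mlead (g j) => le_m.
pose q := (mleadc (g j) / mleadc (g i)) *: ('X_[mj - mi] * g i).
have Iq : I j q by apply: idealZ => //; case: (idI j) => _ _; apply; apply: incI gi.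
pose h := g j - q.
have nh : ~ I j h.
  move=> Ih; apply: ngj; rewrite -[g j](subrK q); case: (idI j) => _ hD _; exact: hD.
have c0 : mleadc (g j) / mleadc (g i) != 0.
  by rewrite mulf_neq0 ?invr_neq0 // mleadc_eq0.
have leadq : mlead q = mj.
  rewrite mleadZ // mleadM //; last by rewrite -msupp_eq0 msuppX.
  by rewrite mleadXm submK.
have Ih : I j.+1 h by apply: idealB => //; apply: incI Iq.
apply: (gmin h) => //; rewrite -/mj.
have : (mlead h <= mj)%O.
  by apply: le_trans (mleadB_le _ _) _; rewrite leadq leUx lexx.
(* If [h] still had leading monomial [mj], its leading coefficient would be 0 by the choice of [q],
   so [h] would be 0 and lie in [I j]. *)
rewrite le_eqVlt => /predU1P[eqm|//]; case: nh.
suff /eqP : mleadc h == 0 by move/eqP; rewrite mleadc_eq0 => /eqP ->; case: (idI j).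
have cf d : mj = (mi + d)%MM -> ('X_[d] * g i)@_mj = mleadc (g i).
  by move=> ->; rewrite mulrC addmC mcoeffMX.
by rewrite eqm mcoeffB mcoeffZ cf ?divfK ?subrr ?mleadc_eq0 // addmC submK.
Qed.

Definition adjoin (I : P -> Prop) (a : P) : P -> Prop :=
  fun g => exists p h, I p /\ g = p + h * a.

Lemma adjoin_ideal I a : is_ideal I -> is_ideal (adjoin I a).
Proof.
move=> idI; case: (idI) => I0 ID IM; split.
- by exists 0, 0; rewrite mul0r addr0.
- move=> _ _ [p [h [Ip ->]]] [p' [h' [Ip' ->]]].
  by exists (p + p'), (h + h'); split; [apply: ID | rewrite mulrDl addrACA].
- move=> r _ [p [h [Ip ->]]].
  by exists (r * p), (r * h); split; [apply: IM | rewrite mulrDr mulrA].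
Qed.

Lemma sub_adjoin (I : P -> Prop) a g : I g -> adjoin I a g.
Proof. by move=> Ig; exists g, 0; rewrite mul0r addr0. Qed.

Lemma mem_adjoin I a : is_ideal I -> adjoin I a a.
Proof. by case=> I0 _ _; exists 0, 1; rewrite mul1r add0r. Qed.

Lemma adjoin_min (I Q : P -> Prop) a : is_ideal Q -> (forall g, I g -> Q g) -> Q a ->
  forall g, adjoin I a g -> Q g.
Proof.
move=> [_ QD QM] IQ Qa _ [p [h [Ip ->]]].
by apply: QD; [apply: IQ | apply: QM].
Qed.

(** The list may be redundant. This avoids speaking of minimal primes, all of which it contains up
    to extensional equality. *)
Definition covering_primes (I : P -> Prop) (s : list (P -> Prop)) : Prop :=
  (forall Q, List.In Q s -> is_prime_ideal Q /\ forall g, I g -> Q g) /\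
  forall Q, is_prime_ideal Q -> (forall g, I g -> Q g) ->
    exists Q', List.In Q' s /\ forall g, Q' g -> Q g.

(** If [I] contains [a * b] but neither factor, every prime over [I] contains [a] or [b], so lists
    for both enlarged ideals would concatenate to one for [I]. *)
Lemma not_covered_step (I : P -> Prop) :
  is_ideal I -> ~ (exists s, covering_primes I s) ->
  exists a, ~ I a /\ ~ (exists s, covering_primes (adjoin I a) s).
Proof.
move=> idI bad; apply: NNPP => hgood.
have good a : ~ I a -> exists s, covering_primes (adjoin I a) s.
  by move=> Ia; apply: NNPP => h; apply: hgood; exists a.
apply: bad; have [I1|I1] := classic (I 1).
  by exists nil; split=> // Q [_ Q1 _] /(_ 1 I1).
have [[a [b [Iab [Ia Ib]]]]|hprime] :=
  classic (exists a b, I (a * b) /\ ~ I a /\ ~ I b); last first.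
  exists (cons I nil); split=> [Q [<-|//]|Q _ IQ]; last by exists I; split=> //; left.
  split=> //; split=> // a b Iab; apply: NNPP => nab; apply: hprime.
  by exists a, b; split=> //; split=> h; apply: nab; [left | right].
have [[s [s1 s2]] [t [t1 t2]]] := (good a Ia, good b Ib).
exists (s ++ t)%list; split=> [Q|Q pQ IQ].
  move=> Qst; case: (List.in_app_or _ _ _ Qst) => [/s1|/t1] [pQ hQ];
    by split=> // g Ig; apply: hQ; apply: sub_adjoin.
have [idQ _ QM] := pQ.
case: (QM a b (IQ _ Iab)) => Qc.
  have [Q' [sQ' hQ']] := s2 Q pQ (adjoin_min idQ IQ Qc).
  by exists Q'; split=> //; apply: List.in_or_app; left.
have [Q' [sQ' hQ']] := t2 Q pQ (adjoin_min idQ IQ Qc).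
by exists Q'; split=> //; apply: List.in_or_app; right.
Qed.

(** Noetherian induction: a counterexample could be enlarged forever, giving a strictly ascending
    chain. *)
Theorem finite_covering_primes (I : P -> Prop) :
  is_ideal I -> exists s, covering_primes I s.
Proof.
move=> idI; apply: NNPP => badI.
pose T := {J : P -> Prop | is_ideal J /\ ~ exists s, covering_primes J s}.
have /functional_choice[next hnext] : forall J : T, exists J' : T,
    (forall g, sval J g -> sval J' g) /\ exists g, sval J' g /\ ~ sval J g.
  case=> J [idJ badJ] /=; have [a [Ja bad']] := not_covered_step idJ badJ.
  exists (exist _ (adjoin J a) (conj (adjoin_ideal a idJ) bad')); split=> /=.
    by move=> g; apply: sub_adjoin.
  by exists a; split=> //; apply: mem_adjoin.
pose seqI j := sval (iter j next (exist _ I (conj idI badI) : T)).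
apply: (@no_ascending_ideals seqI) => j.
- by rewrite /seqI; case: (iter j next _) => J [].
- by move=> g; apply: (hnext _).1.
- exact: (hnext _).2.
Qed.

End Noetherian.

(** * Hyperplane sections *)

Section PrimeChains.
Variables (k : fieldType) (n : nat).
Local Notation P := {mpoly k[n]}.
Hypothesis hinf : infinite_field k.

(** Each [Q] excludes at most one [t]: two excluded values would put [l'], and then [l], in [Q]. *)
Lemma generic_shift (s : list (P -> Prop)) (l l' : P) :
  (forall Q, List.In Q s -> is_ideal Q /\ ~ Q l) ->
  exists bad : seq k, forall t, t \notin bad -> forall Q, List.In Q s -> ~ Q (l + t *: l').
Proof.
elim: s => [|Q s IH] hs; first by exists [::].
have [|bad hbad] := IH; first by move=> Q' Qs; apply: hs; right.
have [idQ Ql] := hs Q (or_introl erefl).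
have [[t0 ht0]|nt] := classic (exists t0, Q (l + t0 *: l')).
  exists (t0 :: bad) => t; rewrite inE negb_or => /andP[tt0 tbad] Q' [<-|]; last exact: hbad.
  move=> ht; apply: Ql; rewrite -[l](addrK (t0 *: l')); apply: idealB => //.
  apply: idealZ => //; suff -> : l' = (t - t0)^-1 *: ((l + t *: l') - (l + t0 *: l')).
    by apply: idealZ => //; apply: idealB.
  by rewrite opprD addrACA subrr add0r -scalerBl scalerA mulVf ?scale1r // subr_eq0.
by exists bad => t /hbad ht Q' [<- h|/ht//]; apply: nt; exists t.
Qed.

(** A vector space over an infinite field is not a finite union of proper subspaces. When [l] lies
    in the new [Q], it is shifted by a multiple of some [l'] outside [Q]. *)
Lemma linear_form_avoiding (s : list (P -> Prop)) :
  (forall Q, List.In Q s -> is_ideal Q) ->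
  exists l : P, l \is 1.-homog /\ forall Q, List.In Q s ->
    (exists l', l' \is 1.-homog /\ ~ Q l') -> ~ Q l.
Proof.
elim: s => [|Q s IH] hs; first by exists 0; rewrite dhomog0.
have [|l [hl ls]] := IH; first by move=> Q' Qs; apply: hs; right.
have idQ := hs Q (or_introl erefl).
have [[l' [hl' Ql']]|nQ] := classic (exists l', l' \is 1.-homog /\ ~ Q l'); last first.
  by exists l; split=> // Q' [<- /nQ|]; last exact: ls.
have [Ql|Ql] := classic (Q l); last first.
  by exists l; split=> // Q' [<-|]; last exact: ls.
(* [s'] keeps the ideals that [l] already avoids, so that the shift does not fall back into them. *)
have [] : exists s', (forall Q', List.In Q' s' -> is_ideal Q' /\ ~ Q' l) /\
    forall Q', List.In Q' s -> ~ Q' l -> List.In Q' s'.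
  have : forall Q', List.In Q' s -> is_ideal Q' by move=> Q' Qs; apply: hs; right.
  elim: (s) => [|R s' IHs] hids; first by exists nil.
  have [|s1 [h1 h2]] := IHs; first by move=> Q' Qs; apply: hids; right.
  have [Rl|Rl] := classic (R l).
    by exists s1; split=> // Q' [<-//|]; apply: h2.
  exists (cons R s1); split=> [Q' [<-|/h1//]|Q' [<-|Qs] nQ]; [|by left|right; exact: h2].
  by split=> //; apply: hids; left.
move=> s' [hs' ss']; have [bad hbad] := generic_shift l' hs'.
have [t] := hinf (0 :: bad); rewrite inE negb_or => /andP[t0 tbad].
exists (l + t *: l'); split; first by rewrite rpredD // rpredZ.
move=> Q' [<- _ ht|Qs hQ']; last by apply: hbad => //; apply: ss' => //; apply: ls.
apply: Ql'; suff -> : l' = t^-1 *: ((l + t *: l') - l) by apply: idealZ => //; apply: idealB.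
by rewrite addrAC subrr add0r scalerA mulVf ?scale1r.
Qed.

Lemma ideal_of_variables (I : P -> Prop) : is_ideal I -> (forall a, I 'X_a) ->
  forall g, I (g - (g@_0%MM)%:MP).
Proof.
move=> idI hX; elim/mpolyind => [|c m p _ _ Ip].
  by rewrite mcoeff0 mpolyC0 subr0; case: idI.
rewrite mcoeffD mpolyCD opprD addrACA; case: (idI) => I0 ID IM; apply: ID => //.
rewrite mcoeffZ mcoeffX; have [->|m0] := eqVneq m 0%MM.
  by rewrite mulr1 mpolyX0 -mul_mpolyC mulr1 subrr.
rewrite mulr0 mpolyC0 subr0; apply: idealZ => //.
have [a ma] : exists a, m a != 0%N.
  apply/existsP; apply: contraR m0; rewrite negb_exists => /forallP h.
  by apply/eqP/mnmP => a; rewrite mnm0E; apply/eqP/negPn/h.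
have /submK <- : (U_(a) <= m)%MM by rewrite lep1mP.
by rewrite mpolyXD; apply: IM.
Qed.

(* [0 < c] excludes the minimal prime of the origin, the only one that may contain
   every linear form. *)
Lemma hyperplane_section (I : P -> Prop) : is_ideal I ->
  exists l : P, l \is 1.-homog /\ forall c, (0 < c)%N ->
    has_prime_chain (fun g => I g \/ g = l) c -> has_prime_chain I c.+1.
Proof.
move=> idI; have [s [s1 s2]] := finite_covering_primes idI.
have [|l [hl ls]] := @linear_form_avoiding s; first by move=> Q /s1[[]].
exists l; split=> // c c0 [Q [hQ hstep]].
have [pQ0 IQ0] := hQ 0%N isT.
have [Q' [sQ' hQ']] := s2 _ pQ0 (fun g Ig => IQ0 g (or_introl Ig)).
have [pQ' IQ'] := s1 _ sQ'.
(* A covering prime [Q'] inside [Q 0] is put in front of the chain; [l] lies in [Q 0] and will be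
   shown to lie outside [Q']. *)
exists (fun j => if j is j'.+1 then Q j' else Q'); split.
  case=> [//|j] hj; split; first by apply: (hQ j hj).1.
  by move=> g Ig; apply: (hQ j hj).2; left.
case=> [_|j hj]; last exact: hstep.
split=> //; exists l; split; first by apply: IQ0; right.
(* If [Q'] contained all linear forms, it would be the maximal ideal of the origin, leaving no room
   for [Q 0] strictly inside the proper ideal [Q 1]. *)
apply: ls => //; apply: NNPP => nl.
have hX a : Q' 'X_a.
  by apply: NNPP => na; apply: nl; exists 'X_a; split=> //; rewrite dhomogX /= mdeg1.
have [_ [g [Q1g Q0g]]] := hstep 0%N c0.
have [[idQ1 Q1 _] _] := hQ 1%N c0.
have [idQ' _ _] := pQ'.
have Qg := hQ' _ (ideal_of_variables idQ' hX g).
have [g0|g0] := eqVneq (g@_0%MM) 0.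
  by apply: Q0g; rewrite g0 mpolyC0 subr0 in Qg.
apply: Q1; apply: (ideal_const idQ1 g0).
rewrite -[_%:MP](subKr g).
by apply: idealB => //; apply: (hstep 0%N c0).1.
Qed.

(** The form [l0] is chosen first and the others for [adjoin I l0], since genericity depends on the
    ideal already cut. *)
Lemma linear_sections m (I : P -> Prop) : is_ideal I ->
  exists l : 'I_m -> P, (forall i, l i \is 1.-homog) /\ forall c, (0 < c)%N ->
    has_prime_chain (fun g => I g \/ exists i, g = l i) c -> has_prime_chain I (c + m).
Proof.
elim: m I => [|m IH] I idI.
  exists (fun=> 0); split=> [i|c _ [Q [hQ hstep]]]; first exact: dhomog0.
  rewrite addn0; exists Q; split=> // j /hQ[pQ IQ]; split=> // g Ig.
  by apply: IQ; left.
have [l0 [hl0 cut0]] := hyperplane_section idI.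
have [l [hl cut]] := IH _ (adjoin_ideal l0 idI).
exists (fun i => if unlift ord0 i is Some i' then l i' else l0); split.
  by move=> i; case: unliftP.
move=> c c0 [Q [hQ hstep]]; rewrite addnS; apply: cut0; first by rewrite addn_gt0 c0.
have [|Q' [hQ' hstep']] := cut c c0.
  exists Q; split=> // j /hQ[pQ IQ]; split=> // g [|[i ->]].
    apply: adjoin_min; first by case: pQ.
      by move=> h Ih; apply: IQ; left.
    by apply: IQ; right; exists ord0; rewrite unlift_none.
  by apply: IQ; right; exists (lift ord0 i); rewrite liftK.
exists Q'; split=> // j /hQ'[pQ IQ]; split=> // g [Ig|->]; apply: IQ.
  exact: sub_adjoin.
exact: mem_adjoin.
Qed.

(** * Primes of a line and of the origin *)

Lemma vanishing_poly0 (p : {poly k}) : (forall t, p.[t] = 0) -> p = 0.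
Proof.
move=> hp; have [s [us ss]] : exists s : seq k, uniq s /\ size s = size p.
  elim: (size p) => [|q [s [us ss]]]; first by exists [::].
  by have [x xs] := hinf s; exists (x :: s); rewrite /= xs us ss.
apply: (roots_geq_poly_eq0 (rs := s)) => //; last by rewrite ss.
by apply/allP => x _; rewrite rootE hp.
Qed.

Lemma restrict_to_line (v : 'I_n -> k) (g : P) :
  exists p : {poly k}, forall t, p.[t] = g.@[fun a => t * v a].
Proof.
exists (\sum_(m <- msupp g) g@_m *: \prod_a (v a *: 'X) ^+ m a) => t.
rewrite horner_sum mevalE; apply: eq_bigr => m _.
rewrite hornerZ horner_prod; congr (_ * _); apply: eq_bigr => a _.
by rewrite horner_exp hornerZ hornerX mulrC.
Qed.

(** Restriction to the line lands in polynomials in one variable, a domain where vanishing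
    everywhere means being zero because [k] is infinite. *)
Lemma line_prime (v : 'I_n -> k) :
  is_prime_ideal (fun g : P => forall t, g.@[fun a => t * v a] = 0).
Proof.
split; first split.
- by move=> t; rewrite meval0.
- by move=> a b ha hb t; rewrite mevalD ha hb addr0.
- by move=> r a ha t; rewrite mevalM ha mulr0.
- by move/(_ 0)/eqP; rewrite meval1 oner_eq0.
move=> a b hab.
have [[p hp] [q hq]] := (restrict_to_line v a, restrict_to_line v b).
have /eqP : p * q = 0 by apply: vanishing_poly0 => t; rewrite hornerM hp hq -mevalM.
rewrite mulf_eq0 => /orP[] /eqP e0; [left|right] => t.
  by rewrite -hp e0 horner0.
by rewrite -hq e0 horner0.
Qed.

Lemma origin_prime : is_prime_ideal (fun g : P => g.@[fun=> 0] = 0).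
Proof.
split; first split.
- by rewrite meval0.
- by move=> a b ha hb; rewrite mevalD ha hb addr0.
- by move=> r a ha; rewrite mevalM ha mulr0.
- by move/eqP; rewrite meval1 oner_eq0.
by move=> a b; rewrite mevalM => /eqP; rewrite mulf_eq0 => /orP[] /eqP; [left|right].
Qed.

Lemma line_chain (J : P -> Prop) (v : 'I_n -> k) (a : 'I_n) : v a != 0 ->
  (forall g, J g -> forall t, g.@[fun b => t * v b] = 0) -> has_prime_chain J 1.
Proof.
move=> va hJ.
have at0 (g : P) : (forall t, g.@[fun b => t * v b] = 0) -> g.@[fun=> 0] = 0.
  by move=> h; rewrite -[RHS](h 0); apply: meval_eq => b; rewrite mul0r.
exists (fun j => if j is 0%N then fun g : P => forall t, g.@[fun b => t * v b] = 0
                 else fun g : P => g.@[fun=> 0] = 0); split.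
  case=> [_|j _]; first by split; [apply: line_prime | apply: hJ].
  by split; [apply: origin_prime | move=> g /hJ /at0].
case=> // _; split=> //; exists 'X_a; rewrite mevalXU; split=> // /(_ 1).
by rewrite mevalXU mul1r => /eqP; rewrite (negPf va).
Qed.

Lemma vanishing_ideal_ideal (S : ('I_n -> k) -> Prop) : is_ideal (vanishing_ideal S).
Proof.
split=> [a _|g h hg hh a Sa|r g hg a Sa]; first exact: meval0.
  by rewrite mevalD hg // hh // addr0.
by rewrite mevalM hg // mulr0.
Qed.

Lemma shorter_prime_chain (J : P -> Prop) L L' :
  (L' <= L)%N -> has_prime_chain J L -> has_prime_chain J L'.
Proof.
move=> le [Q [hQ hstep]]; exists Q.
by split=> j hj; [apply: hQ | apply: hstep]; apply: leq_trans hj le.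
Qed.

End PrimeChains.

(** * Restriction to subspaces and the codimension bound *)

Lemma meval_scale (k : fieldType) n d (f : {mpoly k[n]}) (t : k) (v : 'I_n -> k) :
  f \is d.-homog -> f.@[fun a => t * v a] = t ^+ d * f.@[v].
Proof.
case/polarization => S hS; rewrite !hS /polar big_distrr /=.
apply: eq_bigr => u _; rewrite big_split /= prodr_const card_ord.
by rewrite mulrCA.
Qed.

Lemma comp_mpoly_homog (k : fieldType) n m d (f : {mpoly k[n]})
    (lq : n.-tuple {mpoly k[m]}) :
  (forall a, tnth lq a \is 1.-homog) -> f \is d.-homog -> f \mPo lq \is d.-homog.
Proof.
move=> hl /dhomogP hf; rewrite comp_mpolyEX big_seq; apply: rpred_sum => mo /hf <-.
rewrite /= mdegE comp_mpolyX; apply: rpredZ; apply: dhomog_bigprod => a.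
by have := dhomogMn (mo a) (hl a); rewrite mul1n.
Qed.

(** The left kernel of [M] has dimension at least [n - m], more than [N]. The forms are pulled back
    along a basis of it, whose freeness keeps the solution nonzero. *)
Lemma kpoint_on_subspace (k : fieldType) (r N n m : nat) (e : 'I_r -> nat)
    (f : 'I_r -> {mpoly k[n]}) (M : 'M[k]_(n, m)) :
  (forall n', (N < n')%N -> forall f' : 'I_r -> {mpoly k[n']},
    (forall i, f' i \is (e i).-homog) ->
    exists x : 'I_n' -> k, (exists b, x b != 0) /\ forall i, (f' i).@[x] = 0) ->
  (forall i, f i \is (e i).-homog) -> (N + m < n)%N ->
  exists v : 'rV[k]_n, [/\ v != 0, v *m M = 0 & forall i, (f i).@[fun a => v 0 a] = 0].
Proof.
move=> hN hf hn; pose B := row_base (kermx M).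
pose lq := [tuple \sum_b B b a *: 'X_b | a < n] : n.-tuple {mpoly k[\rank (kermx M)]}.
have [|i|x [[b xb] hx]] := hN _ _ (fun i => f i \mPo lq).
- rewrite mxrank_ker ltn_subRL; apply: leq_ltn_trans hn; rewrite addnC leq_add2l.
  exact: rank_leq_col.
- apply: comp_mpoly_homog => // a; rewrite tnth_mktuple; apply: rpred_sum => b _.
  by apply: rpredZ; rewrite dhomogX /= mdeg1.
pose v := \row_b x b *m B; exists v; split.
- rewrite -(mul0mx _ B) (inj_eq (row_free_inj (row_base_free _))).
  by apply/rV0Pn; exists b; rewrite mxE.
- by apply/sub_kermxP; rewrite -(eq_row_base (kermx M)); apply: submxMl.
move=> i; rewrite -[RHS](hx i) comp_mpoly_meval; apply: meval_eq => a.
rewrite tnth_mktuple raddf_sum mxE; apply: eq_bigr => c _ /=.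
by rewrite mevalZ mevalXU mxE mulrC.
Qed.

Theorem theorem1p3 (k : fieldType) (hinf : infinite_field k) (hbr : brauer_field k)
  (r : nat) (d : 'I_r -> nat) :
  exists C : nat, forall (n : nat) (f : 'I_r -> {mpoly k[n]}),
    (forall i, f i \is (d i).-homog) ->
    codim_le (vanishing_ideal (kpoints f)) (gen_ideal f) C.
Proof.
(* Degree 0 is replaced by 1 because [brauer_upto] asks for positive degrees. *)
pose e i := if d i == 0%N then 1%N else d i.
have he i : (0 < e i)%N by rewrite /e lt0n; case: ifPn.
have [||N hN] := @brauer_systems k hbr (\max_i e i).+1 _ 'I_r e => //.
  by move=> i; rewrite he; apply/leqW/leq_bigmax.
exists N => n f hf L chainL.
have fe i : f i \is (e i).-homog.
  rewrite /e; have [d0|//] := eqVneq (d i) 0%N.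
  (* A form of degree 0 is constant. If it were nonzero, [gen_ideal f] would contain 1 and no prime
     could lie over it, against [chainL]. *)
  suff -> : f i = 0 by exact: dhomog0.
  have fc : f i = ((f i)@_0%MM)%:MP.
    apply/msize1_polyC; rewrite msizeE; apply/bigmax_leqP_seq => m ms _.
    by rewrite (dhomog_mf (hf i) ms) d0.
  rewrite fc; have [->|c0] := eqVneq (f i)@_0%MM 0; first exact: mpolyC0.
  case: chainL => Q [/(_ 0%N isT)[[idQ Q1 _] fQ] _]; case: Q1.
  apply: (ideal_const idQ c0); rewrite -fc; apply: fQ.
  exists (fun j => (j == i)%:R); rewrite (bigD1 i) //= eqxx mul1r big1 ?addr0 //.
  by move=> j /negPf ->; rewrite mul0r.
have hscale t v : kpoints f v -> kpoints f (fun a => t * v a).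
  by move=> fv i; rewrite (meval_scale _ _ (fe i)) fv mulr0.
have Ln := prime_chain_length chainL.
(* As [L <= n], a chain of length [n - N] is enough. *)
apply: (@shorter_prime_chain _ _ _ (n - N)); first exact: leq_sub2r.
have idV := vanishing_ideal_ideal (kpoints f).
have [nN|Nn] := leqP n N.
  (* The truncated difference is 0, and the ideal of the origin alone is a chain: the origin is in
     [Z(k)] as all [e i] are positive. *)
  rewrite (eqP (_ : n - N == 0)%N) ?subn_eq0 //.
  exists (fun _ g => g.@[fun=> 0] = 0); split=> // j _; split; first exact: origin_prime.
  move=> g; apply=> i; have := meval_scale 0 (fun=> 0) (fe i).
  by rewrite mul0r expr0n gtn_eqF // mul0r.
(* After [m] sections a subspace of dimension at least [N + 1] remains; its line of zeros gives
   length 1, and the sections give the other [m]. *)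
pose m := (n - N).-1; have em : (n - N = 1 + m)%N by rewrite add1n prednK // subn_gt0.
have [l [hl cut]] := linear_sections hinf m idV.
rewrite em; apply: cut => //.
have [c hc] := fin_all_exists (fun i => linear_form_eval (hl i)).
have [|v [v0 vM fv]] := kpoint_on_subspace (\matrix_(a, i) c i a) hN fe.
  by rewrite -ltn_subRL em.
have /rV0Pn[a va] := v0.
apply: (line_chain hinf va) => g [hg t|[i ->] t]; first exact/hg/hscale.
rewrite (meval_scale _ _ (hl i)) hc; move/rowP/(_ i): vM; rewrite !mxE => vi.
rewrite [X in _ * X](_ : _ = 0) ?mulr0 // -[RHS]vi.
by apply: eq_bigr => b _; rewrite mxE mulrC.
Qed.
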